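(* Every non-trivial topological space (i.e. with more than one point) admitting a compatible length metric is the image, via a light open mapping, of a simply connected space $X$ with $\operatorname{ind}(X)=1$.
   Context: A length metric is a metric such that any two points are joined by paths of length arbitrarily close to the distance between them; it is compatible if it induces the given topology. A (continuous) mapping is light if every point pre-image is totally disconnected, and open if it maps open sets to open sets. $\operatorname{ind}$ denotes the small inductive (Urysohn–Menger) dimension. *)

(* Defs.v *)
From HB Require Import structures.
From mathcomp Require Import all_boot all_order all_algebra.
From mathcomp Require Import all_classical all_reals all_analysis.

Set Implicit Arguments.
Unset Strict Implicit.
Unset Printing Implicit Defensive.

Import Order.TTheory GRing.Theory Num.Theory.
Import numFieldNormedType.Exports.

Local Open Scope classical_set_scope.
Local Open Scope ring_scope.

(* A path is a function on all of [R] of which only the restriction to [0, 1]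
   matters. *)
Definition path_from_to (R : realType) (T : topologicalType) (x y : T)
    (f : R -> T) : Prop :=
  [/\ {within `[0, 1], continuous f}, f 0 = x & f 1 = y].

Definition is_metric (R : realType) (T : Type) (d : T -> T -> R) : Prop :=
  [/\ forall x y, 0 <= d x y,
      forall x y, d x y = 0 <-> x = y,
      forall x y, d x y = d y x &
      forall x y z, d x z <= d x y + d y z].

Definition compatible (R : realType) (T : topologicalType) (d : T -> T -> R)
    : Prop :=
  forall U : set T,
    open U <->
    forall x, U x -> exists2 e : R, 0 < e & [set y | d x y < e] `<=` U.

(* [itv_partition 0 1 s] means that [0 :: s] is strictly increasing from 0
   to 1; the length may be [+oo]. *)
Definition path_length (R : realType) (T : Type) (d : T -> T -> R)
    (f : R -> T) : \bar R :=
  ereal_sup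
    [set (let F := f \o nth 1 (0 :: s) in
          \sum_(0 <= n < size s) d (F n) (F n.+1))%:E
    | s in itv_partition 0 1].

Definition is_length_metric (R : realType) (T : topologicalType)
    (d : T -> T -> R) : Prop :=
  is_metric d /\
  forall (x y : T) (e : R), 0 < e ->
    exists2 f : R -> T, path_from_to x y f &
      (`|path_length d f - (d x y)%:E| < e%:E)%E.

Definition light (X Y : topologicalType) (p : X -> Y) : Prop :=
  forall y : Y, totally_disconnected (p @^-1` [set y]).

Definition open_map (X Y : topologicalType) (p : X -> Y) : Prop :=
  forall U : set X, open U -> open (p @` U).

Definition path_connected (R : realType) (T : topologicalType) : Prop :=
  forall x y : T, exists f : R -> T, path_from_to x y f.

(* Homotopy relative to the endpoints. *)
Definition path_homotopic (R : realType) (T : topologicalType) (x y : T)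
    (f g : R -> T) : Prop :=
  exists H : R * R -> T,
    [/\ {within `[0, 1] `*` `[0, 1], continuous H},
        forall s, s \in `[0, 1] -> H (s, 0) = f s /\ H (s, 1) = g s &
        forall t, t \in `[0, 1] -> H (0, t) = x /\ H (1, t) = y].

Definition simply_connected (R : realType) (T : topologicalType) : Prop :=
  path_connected R T /\
  forall (x : T) (f : R -> T), path_from_to x x f ->
    path_homotopic x x f (cst x).

Definition frontier (T : topologicalType) (A : set T) : set T :=
  closure A `&` closure (~` A).

(* [ind_lt n T] is ind(T) <= n - 1, the shift by one accommodating the value
   -1 of the empty space. [set_type A] carries the subspace topology of [A],
   whereas [subspace A] would keep the points outside [A]. *)
Fixpoint ind_lt (n : nat) (T : topologicalType) : Prop :=
  if n is m.+1 then
    forall (x : T) (U : set T), open U -> U x ->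
      exists V : set T,
        [/\ open V, V x, V `<=` U & ind_lt m (set_type (frontier V))]
  else forall x : T, False.

(* The dimension ind is defined for regular Hausdorff spaces. *)
Definition ind_eq (T : topologicalType) (n : nat) : Prop :=
  [/\ hausdorff_space T, regular_space T, ind_lt n.+1 T & ~ ind_lt n T].

(* Main.v *)
(* X is the set of pairs (l, g) where g : [0, l] -> Y is a nowhere constant
   1-Lipschitz path issued from a base point, with the distance l + l' - 2 c,
   where c is the length of the longest common initial piece of the two paths;
   p sends a path to its endpoint. X is an R-tree: it contracts along segments
   to any of its points rel that point, the frontier of a ball lies in a sphere
   and spheres are ultrametric, so ind X = 1. A connected set contains the
   segments between its points and p is not constant on any segment, so p is
   light. Extending a path by an arc-length parametrization of an almost
   shortest path shows that p maps balls onto balls. *)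
From HB Require Import structures.
Require Import Defs.
From mathcomp Require Import all_boot all_order all_algebra.
From mathcomp Require Import all_classical all_reals all_analysis.
From mathcomp Require Import lra.

Set Implicit Arguments.
Unset Strict Implicit.
Unset Printing Implicit Defensive.

Import Order.TTheory GRing.Theory Num.Theory.
Import numFieldNormedType.Exports.

Local Open Scope classical_set_scope.
Local Open Scope ring_scope.

(** * R-trees *)

Section metric_topology.
Context {R : realType} {T : metricType R}.
Implicit Types (x y : T) (U : set T).

Lemma open_mdistP U :
  open U <-> forall x, U x -> exists2 e : R, 0 < e & [set y | mdist x y < e] `<=` U.
Proof.
split=> [oU x Ux|H].
  have /nbhs_ballP[e /= e0 eU] : nbhs x U by exact: open_nbhs_nbhs.
  by exists e => // y; rewrite -ballEmdist; exact: eU.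
rewrite openE => x /H[e e0 eU]; apply/nbhs_ballP; exists e => //=.
by rewrite ballEmdist.
Qed.

Lemma open_mdist_lt x (e : R) : open [set y | mdist x y < e].
Proof.
apply/open_mdistP => y /= xy; exists (e - mdist x y) => [|z /=].
  by rewrite subr_gt0.
by have := metric_triangle x y z; lra.
Qed.

Lemma frontier_mdist_lt x (e : R) y :
  frontier [set z | mdist x z < e] y -> mdist x y = e.
Proof.
move=> [cy cy']; apply/eqP; rewrite eq_le !leNgt; apply/andP; split; apply/negP => xy.
- have /cy[z [/= xz]] : nbhs y [set z | mdist y z < mdist x y - e].
    apply: open_nbhs_nbhs; split; first exact: open_mdist_lt.
    by rewrite /= mdistxx subr_gt0.
  by have := metric_triangle x z y; rewrite (metric_sym z); lra.
- have /cy'[z [/= xz]] : nbhs y [set z | mdist y z < e - mdist x y].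
    apply: open_nbhs_nbhs; split; first exact: open_mdist_lt.
    by rewrite /= mdistxx subr_gt0.
  by have := metric_triangle x y z; lra.
Qed.

Lemma mdist_cvgP {S : Type} (F : set_system S) (FF : Filter F) (f : S -> T) x :
  f @ F --> x <-> forall e : R, 0 < e -> \forall s \near F, mdist x (f s) < e.
Proof.
split=> [/cvg_ballP H e e0|H].
  by have := H e e0; apply: filterS => s; rewrite ballEmdist.
by apply/cvg_ballP => e e0; have := H e e0; apply: filterS => s; rewrite ballEmdist.
Qed.

End metric_topology.

(** * Connectedness and small inductive dimension *)

Section inductive_dimension.
Context {R : realType} {T : topologicalType}.

Lemma path_connected_connected : path_connected R T -> connected [set: T].
Proof.
move=> Tpc B [x Bx] [C oC BC] [D cD BD]; apply/seteqP; split=> // y _.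
have [f [fc f0 f1]] := Tpc x y.
have Ic := connected_continuous_connected (@segment_connected R 0 1) fc.
have I01 : (f @` `[0, 1]) `&` B = f @` `[0, 1].
  apply: Ic; last 2 first.
  - by exists C => //; rewrite BC setTI.
  - by exists D => //; rewrite BD setTI.
  by exists x; split => //; exists 0 => //=; rewrite in_itv/= lexx ler01.
have : (f @` `[0, 1]) y by exists 1 => //=; rewrite in_itv/= lexx ler01.
by rewrite -I01 => -[].
Qed.

Lemma frontier0_clopen (V : set T) : open V -> frontier V = set0 -> clopen V.
Proof.
move=> oV V0; split=> // x cVx; apply: contrapT => nVx.
suff : frontier V x by rewrite V0.
by split=> //; exact: subset_closure.
Qed.

Lemma clopen_frontier0 (V : set T) : clopen V -> frontier V = set0.
Proof.
move=> [oV cV]; rewrite /frontier -(closure_id V).1//.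
by rewrite -(closure_id _).1 ?setICr// closedC.
Qed.

(** Dimension at most 0 would give a neighbourhood of [x] that misses [y] and has empty frontier,
    hence a proper non-empty clopen set. *)
Lemma connected_not_ind_lt1 : hausdorff_space T -> connected [set: T] ->
  (exists x y : T, x <> y) -> ~ ind_lt 1 T.
Proof.
move=> Th Tc [x [y xy]] T1.
have [U [oU [/set_mem Ux /set_mem nUy]]] :=
  hausdorff_accessible Th (introN eqP xy).
have [V [oV Vx VU F0]] := T1 x U oU Ux.
have [_ cV] : clopen V.
  apply: frontier0_clopen => //; rewrite -subset0 => z Fz.
  exact: (F0 (exist _ z (mem_set Fz))).
have VT : V = setT.
  by apply: Tc; [exists x|exists V; rewrite ?setTI|exists V; rewrite ?setTI].
by apply: nUy; apply: VU; rewrite VT.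
Qed.

End inductive_dimension.

(** * Segments, contractions and dimension of R-trees *)

Section real_tree.
Context {R : realType} {T : metricType R}.
Implicit Types (x y z w : T) (r s t : R).

(* The four-point condition and the existence of segments characterize
   R-trees among metric spaces. *)
Definition four_point := forall x y z w,
  mdist x y + mdist z w <= mdist x z + mdist y w \/
  mdist x y + mdist z w <= mdist x w + mdist y z.

Definition geodesic := forall x y r, 0 <= r <= mdist x y ->
  exists z, mdist x z = r /\ mdist z y = mdist x y - r.

Hypothesis T4 : four_point.
Hypothesis Tgeo : geodesic.

(** Clamping prolongs each segment by constants to all real parameters, so that the Lipschitz
    estimate below carries no range condition. *)
Let clamp x y r : R := Num.max 0 (Num.min r (mdist x y)).

Definition segment_point x y r : T :=
  xget x [set z | mdist x z = clamp x y r /\ mdist z y = mdist x y - clamp x y r].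

Let clamp_itv x y r : 0 <= clamp x y r <= mdist x y.
Proof.
by rewrite /clamp le_max lexx ge_max mdist_ge0 ge_min lexx orbT.
Qed.

Let clampP x y r :
  [\/ r <= 0 /\ clamp x y r = 0, 0 <= r <= mdist x y /\ clamp x y r = r |
     mdist x y <= r /\ clamp x y r = mdist x y].
Proof.
rewrite /clamp; have D0 := mdist_ge0 x y.
case: (lerP r (mdist x y)) => rD.
  case: (lerP 0 r) => r0; last by apply: Or31; rewrite (ltW r0).
  by apply: Or32.
by apply: Or33; rewrite (ltW rD) (max_idPr D0).
Qed.

Lemma segment_pointP x y r :
  mdist x (segment_point x y r) = clamp x y r /\
  mdist (segment_point x y r) y = mdist x y - clamp x y r.
Proof.
have [z zP] := Tgeo (clamp_itv x y r).
by rewrite /segment_point; case: xgetP => [_ -> //|/(_ z)].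
Qed.

Lemma segment_point0 x y : segment_point x y 0 = x.
Proof.
apply/esym/(@mdist_positivity R); have [-> _] := segment_pointP x y 0.
by rewrite /clamp (min_idPl (mdist_ge0 _ _)) maxxx.
Qed.

Lemma segment_point_end x y : segment_point x y (mdist x y) = y.
Proof.
apply/(@mdist_positivity R); have [_ ->] := segment_pointP x y (mdist x y).
by rewrite /clamp minxx (max_idPr (mdist_ge0 _ _)) subrr.
Qed.

(** Joint control in the parameter and the far end yields continuity of the contraction. By the
    four-point condition the two points are either no farther apart than their clamped parameters,
    or, past the branching of the two segments, no farther apart than [y] and [y']. *)
Lemma segment_point_lipschitz x y y' r r' :
  mdist (segment_point x y r) (segment_point x y' r') <= `|r - r'| + mdist y y'.
Proof.
have [z1 z2] := segment_pointP x y r; have [z1' z2'] := segment_pointP x y' r'.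
move: z1 z2 z1' z2' (clamp_itv x y r) (clamp_itv x y' r').
move: (segment_point x y r) (segment_point x y' r') => z z' z1 z2 z1' z2' c c'.
have D1 := metric_triangle x y y'; have D2 := metric_triangle x y' y.
rewrite (metric_sym y') in D2.
(* The upper clamping bounds [mdist x y] and [mdist x y'] differ by at most [mdist y y']. *)
have mm' : `|clamp x y r - clamp x y' r'| <= `|r - r'| + mdist y y'.
  move: (mdist_ge0 y y') (mdist_ge0 x y) (mdist_ge0 x y').
  have := ler_norm (r - r'); have := ler_norm (r' - r); rewrite (distrC r' r).
  move=> *; rewrite ler_norml.
  by case: (clampP x y r) => -[? ->]; case: (clampP x y' r') => -[? ->];
    apply/andP; split; lra.
suff : mdist z z' <= `|clamp x y r - clamp x y' r'| \/ mdist z z' <= mdist y y'.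
  case=> h; first exact: le_trans h mm'.
  by have := normr_ge0 (r - r'); lra.
have := ler_norm (clamp x y r - clamp x y' r').
have := ler_norm (clamp x y' r' - clamp x y r).
rewrite (distrC (clamp x y' r')).
move: c c' z1 z2 z1' z2'.
move: (clamp x y r) (clamp x y' r') => m m' c c' z1 z2 z1' z2' a1 a2.
have := T4 z z' x y; rewrite (metric_sym z x) (metric_sym z' x) z1 z1' z2.
case=> h1; last by left; lra.
have := T4 z z' x y'; rewrite (metric_sym z x) (metric_sym z' x) z1 z1' z2'.
case=> h2; first by left; lra.
have := T4 y z' x y'; rewrite (metric_sym y x) (metric_sym z' x) z1' z2'.
rewrite (metric_sym y z').
by case=> h3; [left|right]; lra.
Qed.

Lemma tree_path_connected : path_connected R T.
Proof.
move=> x y; exists (fun t => segment_point x y (t * mdist x y)); split.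
- apply: continuous_subspaceT => t; apply/mdist_cvgP => e e0.
  (* Adding 1 keeps the divisor positive even when [x = y]. *)
  have D0 : 0 < mdist x y + 1 by rewrite ltr_wpDl// mdist_ge0.
  near=> s; apply: le_lt_trans (segment_point_lipschitz _ _ _ _ _) _.
  rewrite mdistxx addr0 -mulrBl normrM (ger0_norm (mdist_ge0 _ _)).
  apply: (@le_lt_trans _ _ (`|t - s| * (mdist x y + 1))).
    by rewrite ler_wpM2l// lerDl.
  rewrite -ltr_pdivlMr//; near: s.
  by apply: cvgr_dist_lt => //; rewrite divr_gt0.
- by rewrite mul0r segment_point0.
- by rewrite mul1r segment_point_end.
Unshelve. all: by end_near. Qed.

Lemma tree_simply_connected : simply_connected R T.
Proof.
split=> [|x f [fc f0 f1]]; first exact: tree_path_connected.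
(* Each point of the loop slides to [x] along its own segment; the ends of the loop, being [x], stay
   fixed. *)
exists (fun st => segment_point x (f st.1) ((1 - st.2) * mdist x (f st.1))); split.
- apply/subspace_continuousP => -[s t] [/= sI tI]; apply/mdist_cvgP => e e0.
  move/subspace_continuousP : fc => /(_ s sI) /mdist_cvgP fs.
  set D := mdist x (f s).
  have D0 : 0 < D + 1 by rewrite ltr_wpDl// mdist_ge0.
  have e1 : 0 < e / (4 * (D + 1)) by rewrite divr_gt0// mulr_gt0.
  have e4 : 0 < e / 4 by rewrite divr_gt0.
  have := fs _ e4; rewrite /within /= => /nbhs_ballP[d1 /= d10 h1].
  apply/nbhs_ballP; exists (Num.min d1 (e / (4 * (D + 1)))) => /=.
    by rewrite lt_min d10.
  move=> [s' t'] [/= ss' tt'] [/= s'I t'I].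
  have fss' : mdist (f s) (f s') < e / 4.
    by apply: h1 => //; move: ss'; rewrite /ball /= lt_min => /andP[].
  apply: le_lt_trans (segment_point_lipschitz _ _ _ _ _) _.
  have tt'D : `|t - t'| * D <= e / 4.
    move: tt'; rewrite /ball /= lt_min => /andP[_].
    rewrite ltr_pdivlMr ?mulr_gt0//; have := normr_ge0 (t - t'); lra.
  have D1 := metric_triangle x (f s) (f s').
  have D2 := metric_triangle x (f s') (f s); rewrite (metric_sym (f s')) in D2.
  (* The parameter varies with [t] and with [f s], each contributing at most [e / 4]; the motion of
     the far end [f s] contributes the third [e / 4]. *)
  have -> : (1 - t) * D - (1 - t') * mdist x (f s') =
     (t' - t) * D + (1 - t') * (D - mdist x (f s')) by rewrite /D; lra.
  apply: (@le_lt_trans _ _ (e / 4 + e / 4 + e / 4)); last by lra.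
  apply: lerD; last exact: ltW.
  apply: le_trans (ler_normD _ _) _; rewrite !normrM distrC; apply: lerD.
    by rewrite (ger0_norm (mdist_ge0 _ _)).
  move: t'I; rewrite in_itv /= => /andP[t'0 t'1].
  have t'n : `|1 - t'| <= 1 by rewrite ler_norml; apply/andP; split; lra.
  rewrite -[leRHS]mul1r; apply: ler_pM => //.
  by rewrite ler_norml /D; apply/andP; split; lra.
- move=> s _ /=; rewrite subr0 mul1r subrr mul0r.
  by rewrite segment_point_end segment_point0.
- move=> t _ /=; rewrite f0 f1.
  by rewrite mdistxx mulr0 segment_point0.
Qed.

(** Removing [z] disconnects [x] from [y]: the set [U] of points [w] such that [z] is not between
    [x] and [w] is open, and becomes closed once [z] is added. If [A] missed [z], then [U] would cut
    [A] into relatively clopen pieces, with [x] inside and [y] outside. *)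
Lemma connected_segment (A : set T) x y z : connected A -> A x -> A y ->
  mdist x z + mdist z y = mdist x y -> A z.
Proof.
move=> Ac Ax Ay xzy; apply: contrapT => Az.
pose U := [set w | mdist x w < mdist x z + mdist z w].
have xz : 0 < mdist x z by rewrite mdist_gt0; apply/eqP => xz; rewrite xz in Ax.
have oU : open U.
  apply/open_mdistP => w /= Uw; exists ((mdist x z + mdist z w - mdist x w) / 2).
    by rewrite divr_gt0// subr_gt0.
  move=> w' /=; have := metric_triangle x w w'; have := metric_triangle z w' w.
  by rewrite /U /= (metric_sym w'); lra.
have cU : closed (U `|` [set z]).
  rewrite -openC setCU; apply/open_mdistP => w.
  move=> -[/= /negP]; rewrite -leNgt => xw /eqP wz.
  exists (mdist z w); first by rewrite mdist_gt0 eq_sym.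
  move=> w' /= ww'; split => /=.
    apply/negP; rewrite -leNgt; have := T4 x w z w'.
    (* One alternative forces [mdist z w <= mdist w w'], against the choice of radius; the other
       says that [z] lies between [x] and [w']. *)
    by have := mdist_ge0 z w'; rewrite (metric_sym w z) => ? -[]; lra.
  by move=> w'z; move: ww'; rewrite w'z metric_sym ltxx.
have /(congr1 (fun B : set T => B y)) : A `&` U = A.
  apply: Ac.
  - by exists x; split => //; rewrite /U /= mdistxx (metric_sym z); lra.
  - by exists U.
  - exists (U `|` [set z]) => //; rewrite setIUr.
    suff -> : A `&` [set z] = set0 by rewrite setU0.
    by rewrite -subset0 => w [Aw /= wz]; rewrite wz in Aw.
move=> /= AU; have [_] : (A `&` U) y by rewrite /setI/= AU.
by rewrite /U /= -xzy ltxx.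
Qed.

(** With the centre as fourth point, the equal radii cancel from the four-point condition and the
    ultrametric inequality remains. Balls of the subspace are therefore clopen and have empty
    frontier. *)
Lemma sphere_ind_lt1 (F : set T) x e :
  (forall y, F y -> mdist x y = e) -> ind_lt 1 (set_type F).
Proof.
move=> FS u U oU Uu.
have ultra v w w' : F v -> F w -> F w' -> forall r, mdist v w' < r ->
    mdist w w' < r -> mdist v w < r.
  move=> /FS xv /FS xw /FS xw' r; have := T4 v w x w'.
  by rewrite (metric_sym v x) (metric_sym w x) xv xw xw'; case; lra.
case: oU => W oW WU.
have Wu : W (set_val u) by have : (set_val @^-1` W) u by rewrite WU.
have [r r0 rW] := (open_mdistP W).1 oW _ Wu.
have Fval (v : set_type F) : F (set_val v) by exact: set_mem (valP v).
pose V : set (set_type F) := [set v | mdist (set_val u) (set_val v) < r].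
have oV : open V by exists [set y | mdist (set_val u) y < r]; first exact: open_mdist_lt.
have cV : closed V.
  rewrite -openC; exists (\bigcup_(v in ~` V) [set y | mdist (set_val v) y < r]).
    by apply: bigcup_open => v _; exact: open_mdist_lt.
  apply/seteqP; split => [w /= [v nVv vw] uw|w nVw]; last first.
    by exists w => //=; rewrite mdistxx.
  by apply: nVv; exact: (ultra _ _ (set_val w)) vw.
exists V; split => //.
- by rewrite /V /= mdistxx.
- by move=> v Vv; rewrite -WU; exact: rW.
- by rewrite clopen_frontier0// => -[y] /=; rewrite in_set0.
Qed.

Lemma tree_ind_lt2 : ind_lt 2 T.
Proof.
move=> x U oU Ux; have [e e0 eU] := (open_mdistP U).1 oU _ Ux.
exists [set y | mdist x y < e]; split => //.
- exact: open_mdist_lt.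
- by rewrite /= mdistxx.
- by apply: (@sphere_ind_lt1 _ x e) => y; exact: frontier_mdist_lt.
Qed.

Lemma tree_ind_eq1 : (exists x y : T, x <> y) -> ind_eq T 1.
Proof.
move=> T2; split; [exact: metric_hausdorff|exact: uniform_regular|
  exact: tree_ind_lt2|apply: connected_not_ind_lt1 => //].
- exact: metric_hausdorff.
- exact: path_connected_connected tree_path_connected.
Qed.

End real_tree.

(** * Arc length *)

Section length_bounds.
Context {R : realType} {Y : Type} (d : Y -> Y -> R).
Hypothesis dm : is_metric d.
Variable f : R -> Y.

Let dxx x : d x x = 0. Proof. by case: dm => _ d0 _ _; apply/d0. Qed.
Let d_ge0 x y : 0 <= d x y. Proof. by case: dm. Qed.
Let d_sym x y : d x y = d y x. Proof. by case: dm. Qed.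
Let d_tri x y z : d x z <= d x y + d y z. Proof. by case: dm. Qed.

(** Summed over partitions, the inequality says that [k v - k u] majorizes the length of [f] on
    [u, v]. *)
Definition length_bound (k : R -> R) := k 0 = 0 /\
  forall u v, 0 <= u -> u <= v -> v <= 1 -> d (f u) (f v) <= k v - k u.

Let psum (s : seq R) : R :=
  let F := f \o nth 1 (0 :: s) in \sum_(0 <= n < size s) d (F n) (F n.+1).

Let psum_rcons s v : psum (rcons s v) = psum s + d (f (last 0 s)) (f v).
Proof.
rewrite /psum size_rcons big_nat_recr//=; congr (_ + _).
  apply: eq_big_nat => i /andP[_ si]; rewrite nth_rcons si.
  by case: i si => //= i si; rewrite nth_rcons (ltnW si).
rewrite nth_rcons ltnn eqxx; congr (d (f _) _).
by rewrite -rcons_cons nth_rcons /= ltnS leqnn; have /= := nth_last 1 (0 :: s).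
Qed.

(** Take for [k t] the supremum of the partition sums over [0, t]. Appending [v] to a partition of
    [0, u] adds [d (f u) (f v)] to its sum, which gives the required increment. *)
Lemma path_length_bound (l : R) : (path_length d f <= l%:E)%E ->
  exists2 k, length_bound k & k 1 <= l.
Proof.
move=> fl.
pose A t := [set psum s | s in itv_partition 0 t].
have A1l : ubound (A 1) l.
  move=> _ [s sP <-]; rewrite -lee_fin; apply: le_trans fl.
  by apply: ereal_sup_ubound; exists s.
have Arcons u v a : u < v -> A u a -> A v (a + d (f u) (f v)).
  move=> uv [s [sP /eqP su] <-]; exists (rcons s v); last by rewrite psum_rcons su.
  by split; rewrite ?last_rcons// rcons_path sP su.
have psum_nil : psum [::] = 0 by rewrite /psum big_geq.
have A0 : A 0 = [set 0].
  apply/seteqP; split=> [_ [s /itv_partitionxx -> <-]//|_ ->].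
  by exists [::].
have Asup t : 0 <= t -> t <= 1 -> has_sup (A t).
  move=> t0 t1; split.
    move: t0; rewrite le_eqVlt => /predU1P[<-|t0]; first by rewrite A0; exists 0.
    have : A 0 0 by rewrite A0.
    by move=> /(Arcons _ _ _ t0) ?; eexists; eassumption.
  (* A partition of [0, t] with [t < 1] extends to one of [0, 1] with a sum at least as large. *)
  exists l; move: t1; rewrite le_eqVlt => /predU1P[->//|t1] a /(Arcons _ _ _ t1).
  by move=> /A1l; apply: le_trans; rewrite lerDl.
exists (fun t => sup (A t)); last first.
  by apply: ge_sup => //; case: (Asup 1 ler01 (lexx _)).
split; first by rewrite A0 sup1.
move=> u v u0; rewrite le_eqVlt => /predU1P[->|uv] v1; first by rewrite dxx subrr.
rewrite lerBrDr addrC -lerBrDr; apply: ge_sup.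
  by case: (Asup u u0 (le_trans (ltW uv) v1)).
move=> a /(Arcons _ _ _ uv) Ava; rewrite lerBrDr.
by apply: (ub_le_sup (Asup v (le_trans u0 (ltW uv)) v1).2).
Qed.

Definition minimal_length_bound (h : R -> R) :=
  length_bound h /\ forall k, length_bound k -> h 1 <= k 1.

(* The arc length of [f] is obtained as the pointwise infimum of all length
   bounds, which is again a length bound. *)
Lemma minimal_length_bound_exists (l : R) : (path_length d f <= l%:E)%E ->
  exists2 h, minimal_length_bound h & h 1 <= l.
Proof.
move=> /path_length_bound[k0 k0P k0l].
pose B t := [set k t | k in length_bound].
have Binf t : 0 <= t -> t <= 1 -> has_inf (B t).
  move=> t0 t1; split; first by exists (k0 t), k0.
  exists 0 => _ [k [k00 kP] <-]; have := kP 0 t (lexx _) t0 t1.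
  by rewrite k00 subr0; exact: le_trans.
have hmin k : length_bound k -> inf (B 1) <= k 1.
  by move=> kP; apply: (ge_inf (Binf 1 ler01 (lexx _)).2); exists k.
exists (fun t => inf (B t)); last by apply: le_trans k0l; exact: hmin.
split=> //; split.
  suff -> : B 0 = [set 0] by rewrite inf1.
  by apply/seteqP; split=> [_ [k [? _] <-]//|_ ->]; exists k0 => //; case: k0P.
move=> u v u0 uv v1; rewrite lerBrDr; apply: lb_le_inf.
  by case: (Binf v (le_trans u0 uv) v1).
move=> _ [k kP <-]; have := kP.2 u v u0 uv v1; rewrite lerBrDr.
apply: le_trans; rewrite lerD2l.
by apply: (ge_inf (Binf u u0 (le_trans uv v1)).2); exists k.
Qed.

Section minimal.
Variable h : R -> R.
Hypothesis hP : minimal_length_bound h.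

Lemma length_bound_homo (u v : R) : 0 <= u -> u <= v -> v <= 1 -> h u <= h v.
Proof.
move=> u0 uv v1; rewrite -subr_ge0; apply: le_trans (hP.1.2 _ _ u0 uv v1).
exact: d_ge0.
Qed.

(** Flattening [h] on [s, t] and lowering it by [h t - h s] afterwards gives another length bound,
    because [f] does not move on [s, t]. Minimality then excludes a positive increment. *)
Lemma minimal_length_bound_const (s t : R) : 0 <= s -> s <= t -> t <= 1 ->
  (forall u, s <= u <= t -> f u = f s) -> h t <= h s.
Proof.
move=> s0 st t1 fst; case: (hP) => -[h0 hd] hmin.
pose k u := if u <= s then h u else if u <= t then h s else h u - (h t - h s).
have k1 : k 1 <= h 1 - (h t - h s).
  rewrite /k; case: (leP 1 s) => s1.
    have -> : t = s by apply/le_anti; rewrite st (le_trans t1 s1).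
    by rewrite subrr subr0.
  case: (leP 1 t) => t1' //; have -> : t = 1 by apply/le_anti; rewrite t1.
  by rewrite subKr.
suff /hmin h1 : length_bound k by have := le_trans h1 k1; lra.
split; first by rewrite /k s0 h0.
move=> u v u0 uv v1.
have dst x : s <= x -> x <= t -> f x = f s by move=> *; apply: fst; apply/andP.
rewrite /k; case: (leP u s) => us; case: (leP v s) => vs.
- exact: hd.
- case: (leP v t) => vt.
  + by rewrite (dst v) ?(ltW vs)//; exact: (hd _ _ u0 us (le_trans st t1)).
  + apply: le_trans (d_tri _ (f s) _) _; rewrite -[in d (f s) _](dst t)//.
    have := hd _ _ u0 us (le_trans st t1).
    by have := hd _ _ (le_trans s0 st) (ltW vt) v1; lra.
- by have := lt_le_trans us uv; rewrite ltNge vs.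
- case: (leP u t) => ut; case: (leP v t) => vt.
  + by rewrite (dst u) ?(ltW us)// (dst v) ?(ltW vs)// dxx subrr.
  + rewrite (dst u) ?(ltW us)// -(dst t)//.
    by have := hd _ _ (le_trans s0 st) (ltW vt) v1; lra.
  + by have := lt_le_trans ut uv; rewrite ltNge vt.
  + by have := hd _ _ u0 uv v1; lra.
Qed.

Hypothesis fc : forall (t e : R), 0 <= t <= 1 -> 0 < e -> exists2 c : R, 0 < c &
  forall w, 0 <= w <= 1 -> `|t - w| < c -> d (f t) (f w) < e.

(* A jump of size [J] of [h] across the cut [low] could be removed from [h],
   since [f] is continuous. *)
Lemma minimal_length_bound_no_jump (low : R -> bool) (J : R) :
  low 0 -> ~~ low 1 ->
  (forall u v, 0 <= u -> u <= v -> v <= 1 -> low v -> low u) ->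
  (forall u v, 0 <= u <= 1 -> 0 <= v <= 1 -> low u -> ~~ low v ->
     J <= h v - h u) ->
  J <= 0.
Proof.
move=> low0 low1 lowP lowJ; case: (hP) => -[h0 hd] hmin.
pose k u := if low u then h u else h u - J.
suff /hmin : length_bound k by rewrite /k (negbTE low1); lra.
split; first by rewrite /k low0.
move=> u v u0 uv v1; rewrite /k.
have [lv|nlv] := boolP (low v); first by rewrite (lowP u v)//; exact: hd.
have [lu|nlu] := boolP (low u); last by have := hd u v u0 uv v1; lra.
(* Passing from [u] to [v] through [u'] and [v'] costs at most [h v - h u - J + e], since [h] gains
   at least [J] between [u'] and [v']. *)
suff near e : 0 < e -> exists u' v', [/\ low u' /\ ~~ low v', u <= u', u' <= v',
    v' <= v & d (f u') (f v') < e].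
  apply/ler_addgt0Pl => e /near[u' [v' [[lu' nlv'] uu' u'v' v'v fe]]].
  have u'0 := le_trans u0 uu'; have v'1 := le_trans v'v v1.
  have := hd u u' u0 uu' (le_trans u'v' v'1).
  have := hd v' v (le_trans u'0 u'v') v'v v1.
  have := d_tri (f u) (f u') (f v); have := d_tri (f u') (f v') (f v).
  have := lowJ u' v'; rewrite u'0 v'1 (le_trans u'0 u'v') (le_trans u'v' v'1).
  by move=> /(_ isT isT lu' nlv'); lra.
move=> e0.
pose L := [set w | 0 <= w <= 1 /\ low w].
have Lsup : has_sup L.
  by split; [exists 0; rewrite /L/= lexx ler01|exists 1 => w [/andP[]]].
set t := sup L.
have t01 : 0 <= t <= 1.
  rewrite (ub_le_sup Lsup.2) /L/= ?lexx ?ler01//=; apply: ge_sup; first by case: Lsup.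
  by move=> w [/andP[]].
have Lt w : 0 <= w <= 1 -> low w -> w <= t.
  by move=> w01 lw; apply: (ub_le_sup Lsup.2).
have e2 : 0 < e / 2 by rewrite divr_gt0.
have [c c0 fct] := fc t01 e2.
have [u1 [u101 lu1] tu1] := sup_adherent c0 Lsup; rewrite -/t in tu1.
have ut : u <= t by apply: Lt => //; rewrite u0 (le_trans uv v1).
have lowv w : 0 <= w <= 1 -> low w -> w <= v.
  move=> /andP[_ w1] lw; rewrite leNgt; apply/negP => vw.
  by rewrite (lowP v w (le_trans u0 uv) (ltW vw) w1 lw) in nlv.
have tv : t <= v by apply: ge_sup; [case: Lsup|move=> w [w01 lw]; exact: lowv].
(* Both points lie within [c] of the cut [t]: [u'] is low and at least [u1 > t - c], while [v'] is
   either [v] itself or strictly above [t]. *)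
pose u' := Num.max u u1; pose v' := Num.min v (t + c / 2).
have lu' : low u' by rewrite /u'; case: leP.
have u'01 : 0 <= u' <= 1.
  by rewrite /u'; case: (leP u u1) => // _; rewrite u0 (le_trans uv v1).
have u't := Lt _ u'01 lu'.
have u'c : `|t - u'| < c.
  rewrite ger0_norm ?subr_ge0//; have : u1 <= u' by rewrite le_max lexx orbT.
  by move: tu1; lra.
have tv' : t <= v' by rewrite le_min tv lerDl divr_ge0// ltW.
have v'v : v' <= v by rewrite ge_min lexx.
have v'01 : 0 <= v' <= 1.
  by case/andP: t01 => t0 _; rewrite (le_trans t0 tv') (le_trans v'v v1).
have v'c : `|t - v'| < c.
  rewrite distrC ger0_norm ?subr_ge0//.
  have : v' <= t + c / 2 by rewrite ge_min lexx orbT.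
  by move: c0; lra.
have nlv' : ~~ low v'.
  apply/negP => lv'; have v't := Lt _ v'01 lv'.
  move: lv' v't; rewrite /v'; case: (leP v (t + c / 2)) => _.
    by rewrite (negbTE nlv).
  by move=> _; move: c0; lra.
exists u', v'; split=> //; first by rewrite le_max lexx.
  exact: le_trans tv'.
apply: le_lt_trans (d_tri _ (f t) _) _; rewrite d_sym [e]splitr.
by apply: ltrD; exact: fct.
Qed.

(** Let [t] be the supremum of the points where [h] is at most [a]. If [a] were skipped, [h] would
    jump by at least [|h t - a|], a positive number, across this cut. *)
Lemma minimal_length_bound_onto (a : R) : 0 <= a <= h 1 ->
  exists2 t, 0 <= t <= 1 & h t = a.
Proof.
move=> /andP[a0 a1]; apply: contrapT => na.
have h0 : h 0 = 0 by case: hP => -[].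
have neq t : 0 <= t <= 1 -> h t != a.
  by move=> t01; apply/eqP => hta; apply: na; exists t.
have I0 : (0 <= 0 :> R) && (0 <= 1 :> R) by rewrite lexx ler01.
have I1 : (0 <= 1 :> R) && (1 <= 1 :> R) by rewrite lexx ler01.
pose low u := h u <= a.
have low0 : low 0 by rewrite /low h0.
have low1 : ~~ low 1 by rewrite /low -ltNge lt_neqAle eq_sym neq.
have lowP u v : 0 <= u -> u <= v -> v <= 1 -> low v -> low u.
  by move=> u0 uv v1; apply: le_trans; exact: length_bound_homo.
pose L := [set w | 0 <= w <= 1 /\ low w].
have Lsup : has_sup L by split; [exists 0|exists 1 => w [/andP[]]].
set t := sup L.
have Lt w : 0 <= w <= 1 -> low w -> w <= t.
  by move=> w01 lw; apply: (ub_le_sup Lsup.2).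
have t01 : 0 <= t <= 1.
  by rewrite Lt//=; apply: ge_sup; [case: Lsup|move=> w [/andP[]]].
have highP w : 0 <= w <= 1 -> ~~ low w -> t <= w.
  move=> /andP[w0 w1] nlw; apply: ge_sup; first by case: Lsup.
  move=> w' [/andP[w'0 w'1] lw']; rewrite leNgt; apply/negP => ww'.
  by rewrite (lowP _ _ w0 (ltW ww') w'1 lw') in nlw.
have : `|h t - a| <= 0; last by rewrite normr_le0 subr_eq0 (negbTE (neq _ t01)).
apply: (minimal_length_bound_no_jump low0 low1 lowP).
move=> u v u01 v01 lu nlv; have ut := Lt u u01 lu; have tv := highP v v01 nlv.
have hut : h u <= h t by case/andP: u01 t01 => ? ? /andP[? ?]; exact: length_bound_homo.
have htv : h t <= h v by case/andP: v01 t01 => ? ? /andP[? ?]; exact: length_bound_homo.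
move: lu nlv; rewrite /low -ltNge => hu hv.
by rewrite ler_norml; apply/andP; split; lra.
Qed.

End minimal.
End length_bounds.

(* The values of [g] off [0, l] are fixed so that paths which agree on [0, l]
   are equal as functions. *)
Definition nonstop (R : realType) (Y : Type) (d : Y -> Y -> R) (l : R)
    (g : R -> Y) : Prop :=
  [/\ 0 <= l,
      forall s t, s <= t -> d (g s) (g t) <= t - s,
      forall t, t <= 0 -> g t = g 0,
      forall t, l <= t -> g t = g l &
      forall s t, 0 <= s -> s < t -> t <= l ->
        exists2 u, s <= u <= t & g u <> g s].

Lemma compatible_open_ball (R : realType) (Y : topologicalType)
    (d : Y -> Y -> R) (x : Y) (e : R) :
  is_metric d -> compatible d -> open [set y | d x y < e].
Proof.
move=> [_ _ _ d_tri] dc; apply/dc => y /= xy; exists (e - d x y).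
  by rewrite subr_gt0.
by move=> z /=; have := d_tri x y z; lra.
Qed.

(** Reparametrize [f] by its minimal length bound [h]. Surjectivity of [h] makes this possible, the
    bound on distances makes it 1-Lipschitz, and the absence of growth of [h] where [f] is constant
    makes it nowhere constant. *)
Lemma nonstop_reparametrization (R : realType) (Y : topologicalType)
    (d : Y -> Y -> R) (x y : Y) (f : R -> Y) (l : R) :
  is_metric d -> compatible d -> path_from_to x y f ->
  (path_length d f <= l%:E)%E ->
  exists (m : R) (g : R -> Y), [/\ nonstop d m g, m <= l, g 0 = x & g m = y].
Proof.
move=> dm dc [fc <- <-] /(minimal_length_bound_exists dm)[h hP hl].
have [d_ge0 d0 d_sym d_tri] := dm.
have fce (t e : R) : 0 <= t <= 1 -> 0 < e -> exists2 c : R, 0 < c &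
    forall w, 0 <= w <= 1 -> `|t - w| < c -> d (f t) (f w) < e.
  move=> t01 e0; move/subspace_continuousP : fc => /(_ t).
  rewrite /= in_itv/= => /(_ t01 [set z | d (f t) z < e]).
  case; first apply: open_nbhs_nbhs; first split.
  - exact: compatible_open_ball.
  - by rewrite /= (d0 _ _).2.
  - move=> c /= c0 cP; exists c => // w w01 tw; exact: cP.
have onto := minimal_length_bound_onto dm hP fce.
have h0 : h 0 = 0 by case: hP => -[].
have h1 : 0 <= h 1 by rewrite -h0; exact: (length_bound_homo dm hP).
have fh u v : 0 <= u <= 1 -> 0 <= v <= 1 -> d (f u) (f v) <= `|h u - h v|.
  wlog uv : u v / u <= v => [H u01 v01|/andP[u0 u1] /andP[v0 v1]].
    by have [|/ltW] := leP u v => ?; [|rewrite d_sym distrC]; exact: H.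
  rewrite distrC; apply: le_trans (ler_norm _).
  by case: hP => -[_ hd] _; exact: hd.
have fheq u v : 0 <= u <= 1 -> 0 <= v <= 1 -> h u = h v -> f u = f v.
  move=> u01 v01 huv; apply/d0/le_anti; rewrite d_ge0 andbT.
  by apply: le_trans (fh _ _ u01 v01) _; rewrite huv subrr normr0.
(* A section of [h]; its choice does not affect [f \o tau], as [f] is constant on the fibres of [h]
   in [0, 1]. The default 0 never occurs for [a] in [0, h 1]. *)
pose tau a := xget 0 [set t | 0 <= t <= 1 /\ h t = a].
have tauP a : 0 <= a <= h 1 -> 0 <= tau a <= 1 /\ h (tau a) = a.
  move=> /onto[t t01 ht]; rewrite /tau.
  by case: xgetP => [u -> //|/(_ t)]; rewrite /=; tauto.
pose clamp t := Num.max 0 (Num.min t (h 1)).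
have clamp01 t : 0 <= clamp t <= h 1.
  by rewrite le_max lexx ge_max h1 ge_min lexx orbT.
have clampE t : 0 <= t <= h 1 -> clamp t = t.
  by move=> /andP[t0 t1]; rewrite /clamp (min_idPl t1) (max_idPr t0).
have clamp_lip s t : s <= t -> `|clamp s - clamp t| <= t - s.
  move=> st; rewrite ler_norml /clamp.
  by case: (leP s (h 1)) => ?; case: (leP t (h 1)) => ?;
    [case: (leP 0 s) => ?|case: (leP 0 s) => ?|case: (leP 0 (h 1)) => ?|
     case: (leP 0 (h 1)) => ?]; try (case: (leP 0 t) => ?);
    try (case: (leP 0 (h 1)) => ?); apply/andP; split; lra.
have gh r : 0 <= r <= 1 -> f (tau (clamp (h r))) = f r.
  move=> r01; have hr : 0 <= h r <= h 1.
    case/andP: r01 => r0 r1; apply/andP; split; last exact: (length_bound_homo dm hP).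
    by rewrite -h0; exact: (length_bound_homo dm hP).
  by rewrite clampE//; have [? ?] := tauP _ hr; exact: fheq.
exists (h 1), (f \o tau \o clamp); split=> //=.
- split=> //=.
  + move=> s t st; have [? hs] := tauP _ (clamp01 s); have [? ht] := tauP _ (clamp01 t).
    by apply: le_trans (fh _ _ _ _) _ => //; rewrite hs ht; exact: clamp_lip.
  + move=> t t0; rewrite /clamp (min_idPl (le_trans t0 h1)) (min_idPl h1).
    by rewrite maxxx (max_idPl t0).
  + by move=> t t0; rewrite /clamp minxx (min_idPr t0).
  + move=> s t s0 st t1; apply: contrapT => gs.
    have s01 : 0 <= s <= h 1 by rewrite s0 (le_trans (ltW st)).
    have t01 : 0 <= t <= h 1 by rewrite t1 (le_trans s0 (ltW st)).
    have [/andP[s'0 s'1] hs] := tauP _ s01; have [/andP[t'0 t'1] ht] := tauP _ t01.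
    have st' : tau s <= tau t.
      rewrite leNgt; apply/negP => /ltW ts.
      have := length_bound_homo dm hP t'0 ts s'1.
      by rewrite hs ht leNgt st.
    suff : h (tau t) <= h (tau s) by rewrite hs ht leNgt st.
    (* If the new path were constant on [s, t], then [f] would be constant on [tau s, tau t], since
       [h] maps this interval into [s, t]. *)
    apply: (minimal_length_bound_const dm hP) => // r /andP[sr rt].
    have r0 := le_trans s'0 sr; have r1 := le_trans rt t'1.
    rewrite -(gh r) ?r0// -(clampE s)//; apply: contrapT => ne.
    apply: gs; exists (h r) => //.
    by apply/andP; split; [rewrite -[s]hs|rewrite -[t]ht];
      exact: (length_bound_homo dm hP).
- by rewrite -{1}h0 gh// lexx ler01.
- by rewrite gh// lexx ler01.
Qed.

(** * The tree of paths *)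

Section path_tree.
Context {R : realType} {Y : Type} (d : Y -> Y -> R).

(* Backtracking is not cancelled: a path and its continuation by the reverse
   path are different points of the tree. *)
Record path_tree (dm : is_metric d) (y0 : Y) := PathTree {
  plen : R;
  ptr : R -> Y;
  ptr_nonstop : nonstop d plen ptr;
  ptr0 : ptr 0 = y0 }.

Variables (dm : is_metric d) (y0 : Y).
Local Notation X := (path_tree dm y0).
Implicit Types a b c : X.

Let d_ge0 x y : 0 <= d x y. Proof. by case: dm. Qed.
Let d_sym x y : d x y = d y x. Proof. by case: dm. Qed.
Let d_tri x y z : d x z <= d x y + d y z. Proof. by case: dm. Qed.
Let d_eq x y : d x y <= 0 -> x = y.
Proof.
by move=> xy; case: dm => _ d0 _ _; apply/d0/le_anti; rewrite xy d_ge0.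
Qed.

Lemma plen_ge0 a : 0 <= plen a. Proof. by case: (ptr_nonstop a). Qed.

Lemma ptr_lipschitz a (s t : R) : s <= t -> d (ptr a s) (ptr a t) <= t - s.
Proof. by case: (ptr_nonstop a) => _ H _ _ _; exact: H. Qed.

Lemma ptr_le0 a (t : R) : t <= 0 -> ptr a t = y0.
Proof.
by case: (ptr_nonstop a) => _ _ H _ _ /H ->; exact: ptr0.
Qed.

Lemma path_tree_eq a b : plen a = plen b ->
  (forall t, t <= plen a -> ptr a t = ptr b t) -> a = b.
Proof.
move=> lab pab; have : ptr a = ptr b.
  apply/funext => t; have [/pab//|/ltW lt] := leP t (plen a).
  have [[_ _ _ al _] [_ _ _ bl _]] := (ptr_nonstop a, ptr_nonstop b).
  by rewrite al// bl -?lab// pab.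
case: a b lab {pab} => l g gn g0 [l' g' gn' g0'] /= ll' gg'.
by subst l' g'; congr PathTree; exact: Prop_irrelevance.
Qed.

Lemma path_tree_trunc a (u : R) : 0 <= u -> u <= plen a ->
  exists b, plen b = u /\ forall t, t <= u -> ptr b t = ptr a t.
Proof.
move=> u0 ua; case: (ptr_nonstop a) => l0 g_lip g0 gl g_ns.
have tr_ns : nonstop d u (fun t => ptr a (Num.min t u)).
  split=> //.
  - move=> s t st; have [ut|tu] := leP u t.
      have [us|su] := leP u s; first by have := g_lip u u (lexx _); lra.
      by have := g_lip s u (ltW su); lra.
    have [us|su] := leP u s; last exact: g_lip.
    by have := g_lip u u (lexx _); lra.
  - by move=> t t0; rewrite (min_idPl u0) (min_idPl (le_trans t0 u0)) g0.
  - by move=> t ut; rewrite minxx (min_idPr ut).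
  - move=> s t s0 st tu; have [v /andP[sv vt] ne] := g_ns s t s0 st (le_trans tu ua).
    exists v; first by rewrite sv.
    by rewrite (min_idPl (le_trans vt tu)) (min_idPl (le_trans (le_trans sv vt) tu)).
have tr0 : ptr a (Num.min 0 u) = y0 by rewrite (min_idPl u0) ptr0.
exists (@PathTree dm y0 _ _ tr_ns tr0); split=> //= t tu.
by rewrite (min_idPl tu).
Qed.

Lemma path_tree_cat a (l : R) (g : R -> Y) : nonstop d l g ->
    g 0 = ptr a (plen a) ->
  exists b, [/\ plen b = plen a + l, forall t, t <= plen a -> ptr b t = ptr a t &
    ptr b (plen b) = g l].
Proof.
case=> l0 g_lip gn gl g_ns g0; case: (ptr_nonstop a) => a0 a_lip an al a_ns.
pose h t := if t <= plen a then ptr a t else g (t - plen a).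
have hg t : plen a <= t -> h t = g (t - plen a).
  rewrite le_eqVlt => /predU1P[<-|at_]; first by rewrite /h lexx subrr g0.
  by rewrite /h leNgt at_.
have ha t : t <= plen a -> h t = ptr a t by rewrite /h => ->.
have h_ns : nonstop d (plen a + l) h.
  split.
  - exact: addr_ge0.
  - move=> s t st; have [ta|/ltW at_] := leP t (plen a).
      by rewrite !ha ?(le_trans st)//; exact: a_lip.
    have [sa|/ltW as_] := leP s (plen a); last first.
      by rewrite !hg//; have := g_lip (s - plen a) (t - plen a); rewrite lerD2r; lra.
    rewrite ha// hg//; have := d_tri (ptr a s) (ptr a (plen a)) (g (t - plen a)).
    have := a_lip _ _ sa; have := g_lip 0 (t - plen a); rewrite subr_ge0 -g0.
    by move=> /(_ at_); lra.
  - by move=> t t0; rewrite !ha ?(le_trans t0)//; exact: an.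
  - move=> t lt; rewrite !hg; [|by rewrite lerDl|by apply: le_trans lt; rewrite lerDl].
    by rewrite [plen a + l]addrC addrK; apply: gl; rewrite lerBrDl.
  - move=> s t s0 st tl; have [as_|sa] := leP (plen a) s.
      have [|||u /andP[su ut] ne] := g_ns (s - plen a) (t - plen a).
      + by rewrite subr_ge0.
      + by rewrite ltrD2r.
      + by rewrite lerBlDl.
      have su' : s <= plen a + u by rewrite -lerBlDl.
      exists (plen a + u); first by rewrite su' -lerBrDl.
      by rewrite !hg ?(le_trans as_)// [plen a + u]addrC addrK.
    (* When [s] precedes the junction, a point where the path has moved is already found on the part
       coming from [a]. *)
    have [||u /andP[su ut] ne] := a_ns s (Num.min t (plen a)) s0.
    + by rewrite lt_min st sa.
    + by rewrite ge_min lexx orbT.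
    move: ut; rewrite le_min => /andP[ut ua].
    by exists u; rewrite ?su// !ha// ltW.
have h0 : h 0 = y0 by rewrite ha ?ptr0.
exists (@PathTree dm y0 _ _ h_ns h0); split=> //=.
by rewrite hg ?lerDl// [plen a + l]addrC addrK.
Qed.

Definition agree a b (t : R) := forall u, u <= t -> ptr a u = ptr b u.

Let lcp_set a b := [set t : R | 0 <= t <= Num.min (plen a) (plen b) /\ agree a b t].

Definition lcp a b : R := sup (lcp_set a b).

Let lcp_set_sup a b : has_sup (lcp_set a b).
Proof.
split; last by exists (Num.min (plen a) (plen b)) => t [/andP[]].
exists 0; split; first by rewrite lexx le_min !plen_ge0.
by move=> u u0; rewrite !ptr_le0.
Qed.

(** The supremum is attained: below it the paths agree up to points [w] within [e / 2], and beyond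
    [w] each of them moves by at most [e / 2]. *)
Lemma le_lcpP a b (t : R) : 0 <= t ->
  t <= lcp a b <-> [/\ t <= plen a, t <= plen b & agree a b t].
Proof.
move=> t0; split=> [tc|[ta tb ab]]; last first.
  by apply: (ub_le_sup (lcp_set_sup a b).2); rewrite /lcp_set/= t0 le_min ta tb.
have cab : lcp a b <= Num.min (plen a) (plen b).
  by apply: ge_sup; [case: (lcp_set_sup a b)|move=> w [/andP[]]].
move: (le_trans tc cab); rewrite le_min => /andP[ta tb]; split=> // u ut.
apply/d_eq/ler_addgt0Pl => e e0; rewrite addr0.
have e2 : 0 < e / 2 by rewrite divr_gt0.
have [w [_ abw] cw] := sup_adherent e2 (lcp_set_sup a b); rewrite -/(lcp a b) in cw.
have [uw|/ltW wu] := leP u w.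
  by rewrite abw//; have := ptr_lipschitz b (lexx u); lra.
have := d_tri (ptr a u) (ptr a w) (ptr b u); rewrite (d_sym _ (ptr a w)).
have := ptr_lipschitz a wu; have := ptr_lipschitz b wu; rewrite (abw w)//; lra.
Qed.

Lemma lcp_ge0 a b : 0 <= lcp a b.
Proof.
apply/le_lcpP => //; rewrite !plen_ge0; split=> // u u0.
by rewrite !ptr_le0.
Qed.

Lemma lcpP a b : [/\ lcp a b <= plen a, lcp a b <= plen b & agree a b (lcp a b)].
Proof. exact/(le_lcpP a b (lcp_ge0 a b)). Qed.

Lemma lcp_lel a b : lcp a b <= plen a. Proof. by case: (lcpP a b). Qed.

Lemma lcp_ler a b : lcp a b <= plen b. Proof. by case: (lcpP a b). Qed.

Lemma lcpC a b : lcp a b = lcp b a.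
Proof.
suff H x y : lcp x y <= lcp y x by apply/le_anti; rewrite !H.
have [xl yl xy] := lcpP x y; apply/le_lcpP; first exact: lcp_ge0.
by split=> // u /xy.
Qed.

Lemma lcpaa a : lcp a a = plen a.
Proof. by apply/le_anti; rewrite lcp_lel/=; apply/le_lcpP => //; exact: plen_ge0. Qed.

(** [lcp] is the Gromov product of [tree_dist] based at the path of length 0, and this is
    0-hyperbolicity. Both the triangle inequality and the four-point condition are derived from
    it. *)
Lemma lcp_ultra a b c : lcp a b <= lcp a c \/ lcp b c <= lcp a c.
Proof.
have [al bl ab] := lcpP a b; have [bl' cl bc] := lcpP b c.
have [h|/ltW h] := leP (lcp a b) (lcp b c); [left|right];
  apply/le_lcpP; rewrite ?lcp_ge0//; split=> //.
- exact: le_trans cl.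
- by move=> u uab; rewrite ab// bc// (le_trans uab).
- exact: le_trans al.
- by move=> u ubc; rewrite ab ?bc// (le_trans ubc).
Qed.

Lemma lcp_trunc a b c : lcp a b <= plen c -> plen c <= plen a ->
  agree c a (plen c) -> lcp c b = lcp a b.
Proof.
move=> abc ca cag; apply/le_anti/andP; split; apply/le_lcpP; rewrite ?lcp_ge0//.
- have [cl bl cb] := lcpP c b; split=> //; first exact: le_trans ca.
  by move=> u uc; rewrite -cag ?(le_trans uc)// cb.
- have [al bl ab] := lcpP a b; split=> // u uab.
  by rewrite cag ?(le_trans uab)// ab.
Qed.

Definition tree_dist a b : R := plen a + plen b - 2 * lcp a b.

Lemma tree_distC a b : tree_dist a b = tree_dist b a.
Proof. by rewrite /tree_dist lcpC (addrC (plen a)). Qed.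

Lemma tree_distxx a : tree_dist a a = 0.
Proof. by rewrite /tree_dist lcpaa; lra. Qed.

Lemma tree_dist_eq0 a b : tree_dist a b = 0 -> a = b.
Proof.
rewrite /tree_dist; have [al bl ab] := lcpP a b => D.
have lab : lcp a b = plen a by lra.
by apply: path_tree_eq => [|t ta]; [lra|apply: ab; rewrite lab].
Qed.

Lemma tree_dist_triangle b a c : tree_dist a c <= tree_dist a b + tree_dist b c.
Proof.
have := lcp_ultra a b c; have := lcp_ler a b; have := lcp_lel b c.
by rewrite /tree_dist => ? ? []; lra.
Qed.

Lemma tree_dist_four_point a b c e :
  tree_dist a b + tree_dist c e <= tree_dist a c + tree_dist b e \/
  tree_dist a b + tree_dist c e <= tree_dist a e + tree_dist b c.
Proof.
(* The lengths cancel: [lcp a b + lcp c e] has to dominate one of the other two sums of [lcp] over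
   pairs. *)
have := lcp_ultra a c b; have := lcp_ultra a e b.
have := lcp_ultra c a e; have := lcp_ultra c b e.
rewrite /tree_dist (lcpC c a) (lcpC c b) (lcpC e b).
have [] := leP (lcp a b) (lcp c e) => ?;
move=> [] ? [] ? [] ? [] ?; first [by left; lra|by right; lra].
Qed.

Lemma tree_dist_trunc a c : plen c <= plen a -> agree c a (plen c) ->
  tree_dist a c = plen a - plen c.
Proof.
move=> ca cag; suff lca : lcp a c = plen c by rewrite /tree_dist lca; lra.
apply/le_anti; rewrite lcp_ler/=; apply/le_lcpP; rewrite ?plen_ge0//.
by split=> // u /cag.
Qed.

(** Truncating [a] down to the branch point describes the part of the segment from [a] to [b] that
    belongs to [a]; the endpoints of the truncations run through the values of [a] itself. *)
Lemma tree_dist_trunc_segment a b (u : R) : lcp a b <= u -> u <= plen a ->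
  exists c, [/\ tree_dist a c = plen a - u,
    tree_dist c b = tree_dist a b - (plen a - u) & ptr c (plen c) = ptr a u].
Proof.
move=> abu ua; have [c [cu cag]] := path_tree_trunc (le_trans (lcp_ge0 a b) abu) ua.
move: abu ua cag; rewrite -cu => abu ua cag.
exists c; rewrite tree_dist_trunc//; split=> //; last exact: cag.
by rewrite /tree_dist (lcp_trunc abu ua cag); lra.
Qed.

Lemma tree_dist_geodesic a b (r : R) : 0 <= r <= tree_dist a b ->
  exists c, tree_dist a c = r /\ tree_dist c b = tree_dist a b - r.
Proof.
move=> /andP[r0 rab]; have [ra|/ltW ar] := leP r (plen a - lcp a b).
  have [||c [ac cb _]] := @tree_dist_trunc_segment a b (plen a - r); [lra|lra|].
  by exists c; rewrite ac cb; lra.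
rewrite {1}/tree_dist in rab.
(* Past the branch point one climbs along [b]: of the distance [r], [plen a - lcp a b] is spent
   going down, and the rest is added to the height [lcp a b]. *)
have [||c [bc ca _]] := @tree_dist_trunc_segment b a (r - plen a + 2 * lcp a b).
- by rewrite lcpC; lra.
- by lra.
exists c; rewrite (tree_distC a c) ca (tree_distC c b) bc /tree_dist (lcpC b a).
by split; lra.
Qed.

Definition endpoint a : Y := ptr a (plen a).

Lemma endpoint_lipschitz a b : d (endpoint a) (endpoint b) <= tree_dist a b.
Proof.
have [al bl ab] := lcpP a b; rewrite /endpoint /tree_dist.
have := d_tri (ptr a (plen a)) (ptr a (lcp a b)) (ptr b (plen b)).
have := ptr_lipschitz a al; have := ptr_lipschitz b bl.
by rewrite (d_sym _ (ptr a (lcp a b))) (ab _ (lexx _)); lra.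
Qed.

HB.instance Definition _ := gen_eqMixin (path_tree dm y0).
HB.instance Definition _ := gen_choiceMixin (path_tree dm y0).
HB.instance Definition _ := @isMetric.Build R (path_tree dm y0) tree_dist
  tree_distxx tree_dist_eq0 tree_distC tree_dist_triangle.

End path_tree.

(** * The endpoint map as a light open surjection *)

Section endpoint_map.
Context {R : realType} {Y : topologicalType} (d : Y -> Y -> R).
Variables (dm : is_metric d) (y0 : Y).
Local Notation X := (path_tree dm y0).
Local Notation p := (@endpoint R Y d dm y0).
Implicit Types a b c : X.

Let d0 x : d x x = 0. Proof. by case: dm => _ d0 _ _; apply/d0. Qed.

Lemma mdist_tree a b : mdist a b = tree_dist a b. Proof. by []. Qed.

Lemma path_tree_four_point : four_point (R := R) (T := X).
Proof. by move=> a b c e; rewrite !mdist_tree; exact: tree_dist_four_point. Qed.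

Lemma path_tree_geodesic : geodesic (R := R) (T := X).
Proof. by move=> a b r; rewrite !mdist_tree; exact: tree_dist_geodesic. Qed.

Lemma endpoint_continuous : compatible d -> continuous p.
Proof.
move=> dc; apply/continuousP => U /dc oU; apply/open_mdistP => a /oU[e e0 eU].
exists e => // b /= ab; apply: eU => /=.
exact: le_lt_trans (endpoint_lipschitz _ _) ab.
Qed.

(* [p] runs through the path [a] itself along the segment from [a] down to the
   branch point, and [a] is nowhere constant. *)
Lemma endpoint_light : light p.
Proof.
(* Applied to both orders of [a] and [b], this makes both lengths equal to [lcp a b], so that the
   distance vanishes. *)
suff H (A : set X) a b : connected A -> (forall c, A c -> p c = p a) ->
    A a -> A b -> plen a <= lcp a b.
  move=> y a ay; apply/seteqP; split=> [b [A [Aa Ay Ac] Ab]|_ ->]; last first.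
    exact: connected_component_refl.
  have ya c : A c -> p c = p a by move=> /Ay; rewrite /preimage /= => ->.
  have yb c : A c -> p c = p b by move=> /ya ->; exact/esym/ya.
  apply/esym/tree_dist_eq0; rewrite /tree_dist.
  have := H A a b Ac ya Aa Ab; have := H A b a Ac yb Ab Aa.
  have := lcp_lel a b; have := lcp_ler a b; rewrite (lcpC b a); lra.
move=> Ac Ap Aa Ab; rewrite leNgt; apply/negP => ab.
have seg (u : R) : lcp a b <= u -> u <= plen a -> ptr a u = p a.
  move=> bu ua; have [c [ac cb <-]] := tree_dist_trunc_segment bu ua.
  apply: Ap; apply: (connected_segment path_tree_four_point Ac Aa Ab).
  by rewrite !mdist_tree ac cb; lra.
have [_ _ _ _ /(_ _ _ (lcp_ge0 a b) ab (lexx _))] := ptr_nonstop a.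
by move=> [u /andP[su ut]]; rewrite !seg// ltW.
Qed.

Hypotheses (dl : is_length_metric d) (dc : compatible d).

(** A path from [p a] to [y] of length less than [e] is reparametrized and appended to [a]; the tree
    distance covered is just the added length. *)
Lemma endpoint_ball a y (e : R) : d (p a) y < e ->
  exists2 b, tree_dist a b < e & p b = y.
Proof.
move=> ae; have e0 : 0 < e - d (p a) y by rewrite subr_gt0.
have [f fP fl] := dl.2 (p a) y _ e0.
have [l fll le] : exists2 l : R, (path_length d f <= l%:E)%E & l < e.
  (* An infinite length cannot be close to [d (p a) y]. *)
  move: fl; case: path_length => [l| |] //=; rewrite lte_fin => le.
  by exists l => //; have := ler_norm (l - d (p a) y); lra.
have [m [g [gm ml g0 gy]]] := nonstop_reparametrization dm dc fP fll.
have [b [bl ab bg]] := path_tree_cat gm g0.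
exists b; last by rewrite /endpoint bg.
rewrite tree_distC tree_dist_trunc; first by rewrite bl; lra.
- by rewrite bl lerDl; case: gm.
- by move=> u /ab.
Qed.

Lemma endpoint_open : open_map p.
Proof.
move=> U oU; apply/dc => _ [a Ua <-].
have [e e0 eU] := (open_mdistP U).1 oU a Ua; exists e => // y /= /endpoint_ball[b ab <-].
by exists b => //; exact: eU.
Qed.

Lemma endpoint_onto : range p = [set: Y].
Proof.
have o_ns : nonstop d 0 (cst y0).
  split=> //; first by move=> s t; rewrite d0 subr_ge0.
  by move=> s t s0 st t0; have := le_lt_trans s0 st; rewrite ltNge t0.
pose o : X := PathTree dm o_ns erefl.
apply/seteqP; split=> // y _.
(* Any radius above the distance from the base point to [y] serves here. *)
have [|b _ <-] := @endpoint_ball o y (d (p o) y + 1); first by rewrite ltrDl.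
by exists b.
Qed.

End endpoint_map.

Theorem corollary2 (R : realType) (Y : topologicalType)
    (Y_nontrivial : exists x y : Y, x <> y)
    (Y_length : exists d : Y -> Y -> R, is_length_metric d /\ compatible d) :
  exists (X : topologicalType) (p : X -> Y),
    [/\ simply_connected R X,
        ind_eq X 1 &
        [/\ continuous p, light p, open_map p & range p = [set: Y]]].
Proof.
case: Y_nontrivial => y0 [y1 y01]; case: Y_length => d [dl dc]; have dm := dl.1.
have T4 := @path_tree_four_point R Y d dm y0.
have Tgeo := @path_tree_geodesic R Y d dm y0.
have onto := endpoint_onto dm y0 dl dc.
exists (path_tree dm y0), (@endpoint R Y d dm y0); split.
- exact: tree_simply_connected.
- apply: (tree_ind_eq1 T4 Tgeo).
  have [[a _ ay0] [b _ by1]] : range (@endpoint R Y d dm y0) y0 /\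
      range (@endpoint R Y d dm y0) y1 by rewrite onto.
  by exists a, b => ab; apply: y01; rewrite -ay0 -by1 ab.
- split; [exact: endpoint_continuous|exact: endpoint_light|exact: endpoint_open|
    exact: onto].
Qed.
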